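(* There is an absolute constant $c>0$ such that the following holds. Let $G$ be any graph with treedepth $t$ and maximum degree $d\ge 1$. Then every MWIS-formula of $G$ has at least $2^{c\,t/d}$ gates.
   Context: A treedepth decomposition of $G$ is a rooted forest $F$ with $V(F)=V(G)$ such that for every edge $\{u,v\}$ of $G$, one of $u,v$ is an ancestor of the other in $F$; its depth is the maximum number of vertices on a root-to-leaf path; the treedepth of $G$ is the minimum depth of a treedepth decomposition. A tropical circuit over variables $X$ is a finite directed acyclic graph whose gates have in-degree $0$ or $2$; in-degree-$0$ gates are labeled by a variable of $X$ or the constant $0$, in-degree-$2$ gates by $\max$ or $+$, and one gate is the output. A tropical formula is a tropical circuit in which every gate has out-degree at most $1$. A circuit computes a tropical polynomial over $(\mathbb{R}\cup\{-\infty\},\max,+)$: each gate computes a set of monomials (multisets of variables): a leaf $x$ gives $\{x\}$, a leaf $0$ the empty monomial, a $\max$ gate the union of its children's sets, a $+$ gate all products of one monomial from each child. An MWIS-polynomial of a graph $G$ is a tropical polynomial in variables $V(G)$ such that (1) every monomial is $v_1\cdots v_l$ for an independent set $\{v_1,\dots,v_l\}$ of $G$, and (2) for every independent set (including $\emptyset$) the corresponding monomial occurs. An MWIS-formula of $G$ is a tropical formula over $V(G)$ computing an MWIS-polynomial of $G$. *)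

(* Defs.v *)
From mathcomp Require Import all_boot.
From mathcomp Require Import finmap multiset.

Set Implicit Arguments.
Unset Strict Implicit.
Unset Printing Implicit Defensive.

Local Open Scope nat_scope.

Definition acyclic (T : finType) (e : rel T) : bool :=
  [forall x, forall y, e x y ==> ~~ connect e y x].

Record sgraph : Type := SGraph {
  vertex :> finType;
  adj : rel vertex;
  adj_sym : symmetric adj;
  adj_irrefl : irreflexive adj
}.

Definition degree (G : sgraph) (v : G) : nat := #|[set u | adj v u]|.

Definition max_degree (G : sgraph) : nat := \max_(v : G) degree v.

Definition independent (G : sgraph) (S : {set G}) : bool :=
  [forall u in S, forall v in S, ~~ adj u v].

(* A rooted forest is an acyclic parent map; [None] marks a root. *)

Section Forest.
Variable V : finType.
Implicit Types (F : {ffun V -> option V}) (u v : V).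

Definition parent F : rel V := [rel u v | F v == Some u].

Definition rooted_forest F : bool := acyclic (parent F).

Definition is_root F v : bool := F v == None.

Definition is_leaf F v : bool := [forall w, ~~ parent F v w].

(* Reflexive: every vertex is an ancestor of itself. *)
Definition ancestor F : rel V := connect (parent F).

(* The vertices on the root-to-leaf path ending at the leaf [v] are exactly the
   ancestors of [v]; see [root_path_size] below. *)
Definition depth F : nat :=
  \max_(v | is_leaf F v) #|[set u | ancestor F u v]|.

Lemma root_path_size F r s : rooted_forest F -> is_root F r ->
  path (parent F) r s ->
  size (r :: s) = #|[set u | ancestor F u (last r s)]|.
Proof.
move=> /forallP acF /eqP rootr; elim/last_ind: s => [|s v IHs] /=.
  move=> _; rewrite -(cards1 r); apply: eq_card => u; rewrite !inE.
  apply/eqP/idP => [->|/connectP[p]]; first exact: connect0.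
  case/lastP: p => [|p w] //=; rewrite rcons_path last_rcons => /andP[_].
  by move=> /eqP + rw; rewrite -rw rootr.
rewrite rcons_path last_rcons size_rcons => /andP[ps pv].
have := IHs ps; rewrite /= => ->.
have vN : v \notin [set u | ancestor F u (last r s)].
  by have /forallP/(_ v) := acF (last r s); rewrite pv inE.
rewrite -[LHS]/(true + _) -{1}vN -cardsU1; apply: eq_card => u; rewrite !inE.
apply/orP/idP => [[/eqP->|uv]|/connectP[p]]; first exact: connect0.
  exact: connect_trans uv (connect1 pv).
case/lastP: p => [_ -> /=|p w]; first by left.
rewrite rcons_path last_rcons => /andP[pp pw] vw; right.
apply/connectP; exists p => //.
by move: pw pv; rewrite -vw /parent /= => /eqP-> /eqP[].
Qed.

End Forest.

Definition treedepth_decomposition (G : sgraph) (F : {ffun G -> option G}) : bool :=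
  rooted_forest F &&
  [forall u, forall v, adj u v ==> ancestor F u v || ancestor F v u].

Definition has_decomposition_of_depth (G : sgraph) : pred nat :=
  [pred k | [exists F : {ffun G -> option G},
              treedepth_decomposition F && (depth F == k)]].

Lemma decomposition_exists (G : sgraph) :
  exists k, has_decomposition_of_depth G k.
Proof.
pose F : {ffun G -> option G} := [ffun v =>
  if [pick u | (enum_rank u).+1 == enum_rank v :> nat] is Some u then Some u
  else None].
have parE u v : parent F u v = ((enum_rank u).+1 == enum_rank v :> nat).
  rewrite /parent /= ffunE; case: pickP => [w /eqP Hw|/(_ u)->] //.
  apply/eqP/eqP => [[<-]//|]; rewrite -Hw => -[/val_inj/enum_rank_inj->] //.
have le_anc u v : ancestor F u v -> enum_rank u <= enum_rank v.
  case/connectP => p + ->; elim: p u => [|w p IHp] u //= /andP[].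
  by rewrite parE => /eqP uw /IHp; apply: leq_trans; rewrite -uw.
have anc_le n : forall u v, enum_rank v = enum_rank u + n :> nat -> ancestor F u v.
  elim: n => [|n IHn] u v.
    by rewrite addn0 => /val_inj/enum_rank_inj->; apply: connect0.
  move=> Euv; have lt : (enum_rank u).+1 < #|G|.
    by rewrite (leq_ltn_trans _ (ltn_ord (enum_rank v))) // Euv addnS ltnS leq_addr.
  apply: (connect_trans (y := enum_val (Ordinal lt))).
    by apply: connect1; rewrite parE enum_valK.
  by apply: IHn; rewrite enum_valK /= Euv addnS addSn.
exists (depth F); apply/existsP; exists F; rewrite eqxx andbT.
apply/andP; split.
  apply/forallP => u; apply/forallP => v; apply/implyP; rewrite parE => /eqP uv.
  by apply/negP => /le_anc; rewrite -uv ltnn.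
apply/forallP => u; apply/forallP => v; apply/implyP => _.
case: (leqP (enum_rank u) (enum_rank v)) => [|/ltnW] le; apply/orP; [left|right].
  by apply: (anc_le (enum_rank v - enum_rank u)); rewrite subnKC.
by apply: (anc_le (enum_rank u - enum_rank v)); rewrite subnKC.
Qed.

Definition treedepth (G : sgraph) : nat := ex_minn (decomposition_exists G).

Variant label (X : Type) : Type :=
  | Var of X
  | Zero
  | Max
  | Plus.
Arguments Zero {X}.
Arguments Max {X}.
Arguments Plus {X}.

Definition arity (X : Type) (l : label X) : nat :=
  match l with Var _ | Zero => 0 | Max | Plus => 2 end.

(* [arc h g] is a wire from [h] into [g]. *)
Record circuit (X : Type) : Type := Circuit {
  gate : finType;
  arc : rel gate;
  lab : gate -> label X;
  output : gate;
  arc_acyclic : acyclic arc;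
  in_degree : forall g, #|[set h | arc h g]| = arity (lab g)
}.

Definition is_formula (X : Type) (C : circuit X) : Prop :=
  forall g : gate C, #|[set h | arc g h]| <= 1.

Local Open Scope mset_scope.

(* [computes g m]: the monomial [m] belongs to the set computed at the gate [g].
   The product of monomials is the multiset sum. *)
Inductive computes (X : choiceType) (C : circuit X) : gate C -> {mset X} -> Prop :=
  | computes_var g x :
      lab g = Var x -> computes g [mset x]
  | computes_zero g :
      lab g = Zero -> computes g mset0
  | computes_max g h m :
      lab g = Max -> arc h g -> computes h m -> computes g m
  | computes_plus g h1 h2 m1 m2 :
      lab g = Plus -> arc h1 g -> arc h2 g -> h1 != h2 ->
      computes h1 m1 -> computes h2 m2 -> computes g (m1 `+` m2).

Definition polynomial_of (X : choiceType) (C : circuit X) : {mset X} -> Prop :=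
  computes (output C).

Definition set_monomial (X : finType) (S : {set X}) : {mset X} :=
  seq_mset (enum S).

Definition mwis_polynomial (G : sgraph) (P : {mset G} -> Prop) : Prop :=
  (forall m, P m -> exists2 S : {set G}, independent S & m = set_monomial S) /\
  (forall S : {set G}, independent S -> P (set_monomial S)).

Definition mwis_formula (G : sgraph) (C : circuit G) : Prop :=
  is_formula C /\ mwis_polynomial (polynomial_of C).

(* Main.v *)
(** Give an independent set [S] the hard-core weight [lam ^+ #|S|] with
    [lam = 1 / (2 d)], and let [Z U] be the total weight of the independent sets
    inside [U].  Adding a vertex to [U] multiplies [Z U] by at least
    [q = 1 + lam / 2], since deleting at most [d] neighbours loses at most half of
    the weight.  By induction on the gates, the monomials of a gate [g] with
    support in [U] have total weight at most [size g * Z U / q ^+ td U]: at a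
    max gate both sides add up, and at a plus gate the supports [A] and [B] of the
    children are disjoint without edges between them, so
    [Z A * Z B = Z (A :|: B)] and [td U <= #|U :\: (A :|: B)| + max (td A) (td B)],
    while every vertex of [U] outside [A :|: B] gains a factor [q] in [Z U].  At
    the output all independent sets occur, hence [q ^+ t <= #|gate C|]; Bernoulli
    gives [q ^+ (4 * d) >= 2]. *)

Require Import Defs.
From HB Require Import structures.
From mathcomp Require Import all_boot all_order all_algebra.
From mathcomp Require Import finmap multiset.
From mathcomp Require Import boolp reals exp.
From mathcomp Require Import ring lra.
From mathcomp Require Import fintype finset.
Import Order.TTheory GRing.Theory Num.Theory.
Local Open Scope ring_scope.

Set Implicit Arguments.
Unset Strict Implicit.
Unset Printing Implicit Defensive.

(** * Upper bounds on the treedepth of induced subgraphs, witnessed by lists of ancestors *)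

Section BoundedTreedepth.
Variable G : sgraph.
Implicit Types (U A B : {set G}) (u v w : G) (k : nat) (p : G -> seq G).

(* [p v] lists the strict ancestors of [v], nearest first. *)
Definition ancestor_lists U k p : Prop :=
  [/\ forall v, v \in U -> (size (p v) < k)%N,
      forall v u s, v \in U -> p v = u :: s -> u \in U /\ p u = s
    & forall u v, u \in U -> v \in U -> adj u v -> u \in p v \/ v \in p u].

(** A relation instead of a minimum: the induction on gates produces some [k] with a witnessing
    forest, and only on the whole vertex set is [k] compared with [treedepth]. *)
Definition treedepth_le U k : Prop := exists p, ancestor_lists U k p.

Lemma treedepth_le0 : treedepth_le set0 0.
Proof. by exists (fun=> [::]); split=> [v|v u s|u v]; rewrite inE. Qed.

Lemma treedepth_leW U k k' : (k <= k')%N -> treedepth_le U k -> treedepth_le U k'.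
Proof.
move=> lekk' [p [szp pS pE]]; exists p; split=> // v /szp ltk.
exact: leq_trans ltk lekk'.
Qed.

(** [v] becomes a root above all former roots. Lists start at the nearest ancestor, so [v] is
    appended at their far end; being an ancestor of every other vertex, it covers all its edges. *)
Lemma treedepth_leU1 v U k :
  v \notin U -> treedepth_le U k -> treedepth_le (v |: U) k.+1.
Proof.
move=> vU [p [szp pS pE]].
exists (fun w => if w == v then [::] else rcons (p w) v).
split=> [w|w u s|u w].
- case: eqP => //= wv; rewrite in_setU1 size_rcons ltnS; case/predU1P => //; exact: szp.
- case: eqP => // wv; rewrite in_setU1; case/predU1P => // wU.
  case Ep: (p w) => [|x r] /= [<- <-]; first by rewrite setU11 eqxx.
  have [xU ->] := pS _ _ _ wU Ep.
  by rewrite in_setU1 xU orbT; case: eqP xU vU => // -> ->.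
- rewrite !in_setU1; case: (eqVneq u v) => [->|uv] /=.
    case: (eqVneq w v) => [->|wv] /=; first by rewrite adj_irrefl.
    by rewrite mem_rcons mem_head; left.
  case: (eqVneq w v) => [->|wv] /= uU wU; first by rewrite mem_rcons mem_head; right.
  by case/(pE _ _ uU wU) => H; [left|right]; rewrite mem_rcons in_cons H orbT.
Qed.

(** The vertices of [U :\: A] are put back one at a time, each as a new root costing one level. *)
Lemma treedepth_le_superset A U k :
  A \subset U -> treedepth_le A k -> treedepth_le U (k + #|U :\: A|).
Proof.
move Dn: #|U :\: A| => n; elim: n U Dn => [|n IHn] U Dn AU tdA.
  rewrite addn0; suff -> : U = A by [].
  by apply/eqP; rewrite eqEsubset AU andbT -setD_eq0 -cards_eq0 Dn.
have [v] : exists v, v \in U :\: A by apply/card_gt0P; rewrite Dn.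
rewrite inE => /andP[vA vU]; rewrite -(setD1K vU) addnS.
apply: treedepth_leU1; first by rewrite !inE eqxx.
apply: IHn => //; last by rewrite subsetD1 AU.
apply/eqP; rewrite -eqSS -Dn (cardsD1 v (U :\: A)) !inE vA vU /= eqSS.
by apply/eqP; apply: eq_card => x; rewrite !inE andbCA.
Qed.

Definition separated A B : Prop :=
  forall a b, a \in A -> b \in B -> (a != b) && ~~ adj a b.

Lemma separated_sym A B : separated A B -> separated B A.
Proof. by move=> sAB b a bB aA; rewrite eq_sym adj_sym; apply: sAB. Qed.

(** The two forests stand side by side, since no edge joins [A] to [B]. Separation also makes the
    sets disjoint, so membership in [A] decides which list to use. *)
Lemma treedepth_leU A B k : separated A B ->
  treedepth_le A k -> treedepth_le B k -> treedepth_le (A :|: B) k.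
Proof.
move=> sAB [p [szp pS pE]] [p' [szp' pS' pE']].
have BA v : v \in B -> (v \in A) = false.
  by move=> vB; apply/negP => /sAB/(_ vB); rewrite eqxx.
exists (fun w => if w \in A then p w else p' w).
split=> [w|w u s|u w]; rewrite ?in_setU.
- by case: ifP => [/szp|_ /szp'].
- case: ifP => [wA _ /(pS _ _ _ wA)[uA <-]|_ /= wB /(pS' _ _ _ wB)[uB <-]].
    by rewrite uA.
  by rewrite uB BA // orbT.
- case uA: (u \in A); case wA: (w \in A) => //= uB wB uw.
  + exact: pE.
  + by have := sAB _ _ uA wB; rewrite uw andbF.
  + by have := sAB _ _ wA uB; rewrite adj_sym uw andbF.
  + exact: pE'.
Qed.

(** Take the head of [p v] as the parent of [v]. The tail condition of [ancestor_lists] then makes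
    [v :: p v] enumerate the ancestors of [v], and lists grow along parent arcs, which excludes
    cycles. *)
Lemma treedepth_le_treedepth k : treedepth_le [set: G] k -> (treedepth G <= k)%N.
Proof.
move=> [p [szp pS pE]].
pose F : {ffun G -> option G} := [ffun v => ohead (p v)].
have parP u v : parent F u v -> p v = u :: p u.
  rewrite /parent /= ffunE; case Ep: (p v) => [|x s] //= /eqP[<-].
  by have [_ ->] := pS _ _ _ (in_setT _) Ep.
have ancP u v : ancestor F u v -> u \in v :: p v.
  case/connectP=> s + ->; elim/last_ind: s => [|s w IHs]; first by rewrite mem_head.
  rewrite rcons_path last_rcons => /andP[/IHs us /parP ->].
  by rewrite in_cons us orbT.
have ancI u v : u \in v :: p v -> ancestor F u v.
  move Es: (p v) => s; elim: s v Es => [|x s IHs] v Ep.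
    by rewrite inE => /eqP->; apply: connect0.
  rewrite in_cons; case/predU1P => [->|]; first exact: connect0.
  have [_ px] := pS _ _ _ (in_setT _) Ep; move/(IHs _ px).
  move/connect_trans; apply; apply: connect1.
  by rewrite /parent /= ffunE Ep.
have size_anc u v : ancestor F u v -> (size (p u) <= size (p v))%N.
  case/connectP=> s + ->; elim: s u => //= w s IHs u /andP[/parP Ew /IHs].
  by apply: leq_trans; rewrite Ew.
have decF : treedepth_decomposition F.
  apply/andP; split.
    apply/forallP => u; apply/forallP => v; apply/implyP => /parP Ev.
    by apply/negP => /size_anc; rewrite Ev ltnn.
  apply/forallP => u; apply/forallP => v; apply/implyP => uv.
  by apply/orP; case: (pE u v) => // H; [left|right]; apply: ancI; rewrite in_cons H orbT.
rewrite /treedepth; case: ex_minnP => m _ /(_ (depth F)) minm.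
apply: leq_trans (minm _) _.
  by apply/existsP; exists F; rewrite decF eqxx.
apply/bigmax_leqP => v _.
(* The strict bound on [size (p v)] leaves room for [v], which [ancestor] counts as its own
   ancestor. *)
apply: leq_trans (szp v (in_setT _)); rewrite -[X in (_ <= X)%N]/(size (v :: p v)).
apply: leq_trans (card_size _); apply: subset_leq_card.
by apply/subsetP => u; rewrite inE => /ancP.
Qed.

End BoundedTreedepth.

(** * Hard-core weights of families of independent sets *)

Section HardCore.
Variables (R : realFieldType) (G : sgraph) (lam : R).
Hypothesis lam_gt0 : 0 < lam.
Implicit Types (U W A B S : {set G}) (M : {set {set G}}) (v : G).

Definition weight (M : {set {set G}}) : R := \sum_(S in M) lam ^+ #|S|.

Definition indeps U : {set {set G}} := [set S | independent S & S \subset U].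

Lemma weight_ge0 M : 0 <= weight M.
Proof. by apply: sumr_ge0 => S _; apply/exprn_ge0/ltW. Qed.

Lemma weightS M M' : M \subset M' -> weight M <= weight M'.
Proof.
move=> sMM'; rewrite /weight [leRHS](big_setID M) /= (setIidPr sMM') lerDl.
exact: weight_ge0.
Qed.

Lemma weightU M M' : weight (M :|: M') <= weight M + weight M'.
Proof.
rewrite /weight (big_setID M) /= setUK lerD2l.
by apply: weightS; rewrite setDUl setDv set0U subsetDl.
Qed.

Lemma weight_setU1 v M : (forall S, S \in M -> v \notin S) ->
  weight [set v |: S | S in M] = lam * weight M.
Proof.
move=> vM; rewrite /weight big_imset /=.
  by rewrite mulr_sumr; apply: eq_bigr => S /vM vS; rewrite cardsU1 vS exprS.
by move=> S S' /vM vS /vM vS' E; rewrite -(setU1K vS) -(setU1K vS') E.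
Qed.

Lemma weight_mul M M' :
  weight M * weight M' = \sum_(P in setX M M') lam ^+ (#|P.1| + #|P.2|).
Proof.
rewrite /weight big_distrlr /= pair_big /=.
apply: eq_big => [[S S']|[S S'] _]; rewrite ?inE //=.
by rewrite exprD.
Qed.

Lemma independentS S S' : S \subset S' -> independent S' -> independent S.
Proof.
move=> /subsetP sSS' /forall_inP iS'; apply/forall_inP => u /sSS'/iS'/forall_inP iu.
by apply/forall_inP => v /sSS'/iu.
Qed.

Lemma indepsS U W : U \subset W -> indeps U \subset indeps W.
Proof.
move=> UW; apply/subsetP => S; rewrite !inE => /andP[-> SU].
exact: subset_trans SU UW.
Qed.

Lemma weight_indeps0 : weight (indeps set0) = 1.
Proof.
rewrite /weight (big_pred1 set0) ?cards0 // => S.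
rewrite !inE subset0 andb_idl // => /eqP->.
by apply/forall_inP => u; rewrite inE.
Qed.

(** Removing [v] from the independent sets that contain it gives distinct independent sets inside
    [W], at the cost of one factor [lam]. *)
Lemma weight_indepsU1_le v W :
  weight (indeps (v |: W)) <= weight (indeps W) + lam * weight (indeps W).
Proof.
case: (boolP (v \in W)) => vW.
  have /setUidPr -> : [set v]%SET \subset W by rewrite sub1set.
  by rewrite lerDl mulr_ge0 ?weight_ge0 // ltW.
rewrite -(@weight_setU1 v); last first.
  by move=> S; rewrite inE => /andP[_ /subsetP SW]; apply: contra (SW v) vW.
apply: le_trans (weightU _ _); apply: weightS; apply/subsetP => S.
rewrite !inE => /andP[iS]; rewrite -subDset => SW.
case: (boolP (v \in S)) => vS.
  apply/orP; right; apply/imsetP; exists (S :\ v); last by rewrite setD1K.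
  by rewrite inE SW (independentS _ iS) // subsetDl.
apply/orP; left; rewrite iS; apply/subsetP => x xS; apply: (subsetP SW).
by rewrite !inE xS andbT; apply: contraNneq vS => <-.
Qed.

(** The vertices of [N] are deleted one by one; by [weight_indepsU1_le] each deletion loses at most
    [lam] times a weight bounded by that of [W]. *)
Lemma weight_indepsD W N :
  weight (indeps W) <= weight (indeps (W :\: N)) + #|N|%:R * lam * weight (indeps W).
Proof.
move Dn: #|N| => n; elim: n N Dn => [|n IHn] N Dn.
  move/eqP: Dn; rewrite cards_eq0 => /eqP->.
  by rewrite setD0 !mul0r addr0.
have [v vN] : exists v, v \in N by apply/card_gt0P; rewrite Dn.
have {}Dn : #|N :\ v| = n by move: Dn; rewrite (cardsD1 v) vN => -[].
apply: le_trans (IHn _ Dn) _; rewrite -natr1 mulrDl mulrDl mul1r.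
rewrite [leRHS]addrCA [leRHS]addrC lerD2r.
have step : weight (indeps (W :\: (N :\ v))) <=
    weight (indeps (W :\: N)) + lam * weight (indeps (W :\: N)).
  apply: le_trans (weight_indepsU1_le v _); apply/weightS/indepsS.
  apply/subsetP => x; rewrite !inE.
  by case: (x == v); case: (x \in N).
apply: le_trans step _; rewrite lerD2l ler_pM2l //.
by apply/weightS/indepsS/subsetDl.
Qed.

(** By [weight_indepsD], the independent sets avoiding the neighbours of [v] carry at least half the
    weight of [W]. Adding [v] to them gives new independent sets, of total weight at least [lam / 2]
    times that of [W]. *)
Lemma weight_indepsU1_ge v W : 2 * (degree v)%:R * lam <= 1 -> v \notin W ->
  (1 + lam / 2) * weight (indeps W) <= weight (indeps (v |: W)).
Proof.
move=> deg_v vW; pose N := [set u | adj v u]%SET.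
have half : weight (indeps W) <= 2 * weight (indeps (W :\: N)).
  have := weight_indepsD W N; rewrite -[#|N|]/(degree v) => leW.
  have := ler_wpM2r (weight_ge0 (indeps W)) deg_v; lra.
have vN S : S \in indeps (W :\: N) -> v \notin S.
  rewrite inE => /andP[_ /subsetP SW]; apply: contra (SW v) _.
  by rewrite !inE (negPf vW) andbF.
pose M := [set v |: S | S in indeps (W :\: N)]%SET.
have MW : [disjoint indeps W & M].
  rewrite -setI_eq0; apply/eqP/setP => S; rewrite !inE; apply/negP.
  move=> /andP[/andP[_ /subsetP/(_ v) vS] /imsetP[S' _ ES]].
  by rewrite ES setU11 (negPf vW) in vS; have := vS isT.
apply: (@le_trans _ _ (weight (indeps W :|: M))).
  rewrite [leRHS]/weight (big_setID (indeps W)) /= setUK setDUl setDv set0U.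
  move: MW; rewrite disjoint_sym => /setDidPl->.
  rewrite -/(weight _) -/(weight M) weight_setU1 //.
  have := ler_wpM2l (ltW lam_gt0) half; lra.
apply: weightS; rewrite subUset indepsS ?subsetUr //=.
apply/subsetP => _ /imsetP[S + ->]; rewrite !inE => /andP[iS SWN].
have [SW SN] : S \subset W /\ [disjoint S & N] by apply/andP; rewrite -subsetD.
rewrite setUS // andbT.
have adjN u : u \in S -> adj v u = false.
  by move=> uS; have := disjointFr SN uS; rewrite inE.
apply/forall_inP => a; rewrite in_setU1 => aS; apply/forall_inP => b.
rewrite in_setU1; case/predU1P: aS => [->|aS]; case/predU1P => [->|bS].
- by rewrite adj_irrefl.
- by rewrite adjN.
- by rewrite adj_sym adjN.
- by move/forall_inP: iS => /(_ _ aS)/forall_inP/(_ _ bS).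
Qed.

Lemma weight_indeps_superset A U : A \subset U ->
  (forall v : G, 2 * (degree v)%:R * lam <= 1) ->
  weight (indeps A) * (1 + lam / 2) ^+ #|U :\: A| <= weight (indeps U).
Proof.
move=> AU degG; move Dn: #|U :\: A| => n; elim: n U Dn AU => [|n IHn] U Dn AU.
  by rewrite expr0 mulr1; apply/weightS/indepsS.
have [v] : exists v, v \in U :\: A by apply/card_gt0P; rewrite Dn.
rewrite inE => /andP[vA vU]; rewrite -(setD1K vU).
apply: le_trans (weight_indepsU1_ge (degG v) _); last by rewrite !inE eqxx.
rewrite exprS mulrCA ler_pM2l; last by have := lam_gt0; lra.
apply: IHn; last by rewrite subsetD1 AU.
apply/eqP; rewrite -eqSS -Dn (cardsD1 v (U :\: A)) !inE vA vU /= eqSS.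
by rewrite setDDl setUC -setDDl.
Qed.

(** A pair of independent sets is sent to its union, which is independent by separation. The map is
    injective because the traces on [A] and [B] recover the pair. *)
Lemma weight_indeps_separated A B : separated A B ->
  weight (indeps A) * weight (indeps B) <= weight (indeps (A :|: B)).
Proof.
move=> sAB; rewrite weight_mul.
have AB0 : A :&: B = set0.
  apply/setP => x; rewrite !inE; apply/negP => /andP[/sAB + xB] => /(_ _ xB).
  by rewrite eqxx.
have trace (S S' : {set G}) :
    S \subset A -> S' \subset B -> ((S :|: S') :&: A = S) /\ ((S :|: S') :&: B = S').
  move=> SA SB; have [SB0 SA0] : S :&: B = set0 /\ S' :&: A = set0.
    by split; apply/eqP; rewrite -subset0 -AB0 ?setSI // setIC setIS.
  by rewrite !setIUl SB0 SA0 setU0 set0U; split; apply/setIidPl.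
pose h (P : {set G} * {set G}) := P.1 :|: P.2.
have h_inj : {in setX (indeps A) (indeps B) &, injective h}.
  move=> [S1 S2] [S3 S4]; rewrite !inE /h /=.
  move=> /andP[/andP[_ S1A] /andP[_ S2B]] /andP[/andP[_ S3A] /andP[_ S4B]] E.
  have [E1 E2] := trace _ _ S1A S2B; have [E3 E4] := trace _ _ S3A S4B.
  by congr pair; [rewrite -E1 E E3 | rewrite -E2 E E4].
apply: (@le_trans _ _ (weight (h @: setX (indeps A) (indeps B)))).
  rewrite [leRHS]/weight big_imset //=; apply: ler_sum => -[S S'].
  rewrite !inE /h /= => /andP[/andP[_ SA] /andP[_ SB]].
  rewrite cardsU (_ : S :&: S' = set0) ?cards0 ?subn0 //.
  by apply/eqP; rewrite -subset0 -AB0 setISS.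
apply: weightS; apply/subsetP => _ /imsetP[[S S'] + ->].
rewrite !inE /h /= => /andP[/andP[iS SA] /andP[iS' SB]].
rewrite setUSS // andbT.
apply/forall_inP => a; rewrite in_setU => aS; apply/forall_inP => b.
rewrite in_setU; case/orP: aS => aS; case/orP => bS.
- by move/forall_inP: iS => /(_ _ aS)/forall_inP/(_ _ bS).
- by have /andP[] := sAB _ _ (subsetP SA _ aS) (subsetP SB _ bS).
- by rewrite adj_sym; have /andP[] := sAB _ _ (subsetP SA _ bS) (subsetP SB _ aS).
- by move/forall_inP: iS' => /(_ _ aS)/forall_inP/(_ _ bS).
Qed.

(** Expand the product over pairs, keep the pairs whose union lies in [M], and group them by union:
    the group of [S] contains a pair whose term equals the weight of [S]. *)
Lemma weight_le_mul M M1 M2 :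
  (forall S, S \in M -> exists S1 S2, [/\ S1 \in M1, S2 \in M2,
      S = S1 :|: S2 & #|S| = (#|S1| + #|S2|)%N]) ->
  weight M <= weight M1 * weight M2.
Proof.
move=> split_M; rewrite weight_mul.
pose good (P : {set G} * {set G}) := (P.1 :|: P.2 \in M) && (P \in setX M1 M2).
apply: (@le_trans _ _ (\sum_(P | good P) lam ^+ (#|P.1| + #|P.2|))); last first.
  rewrite [leRHS](bigID (fun P => P.1 :|: P.2 \in M)) /=.
  rewrite [X in _ <= X + _](eq_bigl good) => [|P]; last by rewrite /good andbC.
  by rewrite lerDl; apply: sumr_ge0 => P _; apply/exprn_ge0/ltW.
rewrite (partition_big (fun P => P.1 :|: P.2) (fun S => S \in M)) /=; last first.
  by move=> P /andP[].
apply: ler_sum => S SM; have [S1 [S2 [S1M S2M ES cS]]] := split_M _ SM.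
rewrite (bigD1 (S1, S2)) /=; last by rewrite /good /= -ES SM !inE S1M S2M eqxx.
by rewrite cS lerDl; apply: sumr_ge0 => P _; apply/exprn_ge0/ltW.
Qed.

End HardCore.

(** * Square-free monomials and their factors *)

Section SetMonomial.
Local Open Scope mset_scope.
Local Open Scope ring_scope.
Variable X : finType.
Implicit Types (S : {set X}) (m : {mset X}).

Lemma set_monomialE S x : set_monomial S x = (x \in S).
Proof. by rewrite /set_monomial mset_seqE count_uniq_mem ?enum_uniq // mem_enum. Qed.

Lemma set_monomial_inj : injective (@set_monomial X).
Proof.
move=> S S' /msetP E; apply/setP => x.
by have := E x; rewrite !set_monomialE; do 2 case: (_ \in _).
Qed.

(** Multiplicities add up to at most one, so those of a factor are zero or one and its support
    determines it. *)
Lemma set_monomial_factor m m' S : (m `+` m')%mset = set_monomial S ->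
  exists2 S', m' = set_monomial S' & S' \subset S.
Proof.
move=> /msetP E; exists [set x | m' x != 0%N]%SET.
  apply/msetP => x; rewrite set_monomialE inE.
  have := E x; rewrite set_monomialE msetE2.
  by case: (x \in S); case: (m' x) => [|[|n]] //; rewrite !addnS.
apply/subsetP => x; rewrite inE; have := E x; rewrite set_monomialE msetE2.
by case: (x \in S); case: (m' x) => //= n; rewrite addnS.
Qed.

Lemma set_monomialD S1 S2 S :
  (set_monomial S1 `+` set_monomial S2)%mset = set_monomial S ->
  S = S1 :|: S2 /\ [disjoint S1 & S2].
Proof.
move=> /msetP E; split.
  apply/setP => x; have := E x; rewrite inE msetE2 !set_monomialE.
  by do 3 case: (_ \in _).
rewrite -setI_eq0; apply/eqP/setP => x; have := E x.
by rewrite !inE msetE2 !set_monomialE; do 3 case: (_ \in _).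
Qed.

End SetMonomial.

(** * Subformulas and their sizes *)

Section Formula.
Local Open Scope mset_scope.
Local Open Scope ring_scope.
Variables (X : choiceType) (C : circuit X).
Implicit Types g h : gate C.
Local Notation arc := (@Defs.arc _ C).

Definition formula_size g : nat := #|[set h | connect arc h g]%SET|.

Lemma computes_inv g m : computes g m ->
  match lab g with
  | Var x => m = [mset x]%mset
  | Zero => m = mset0
  | Max => exists2 h, arc h g & computes h m
  | Plus => exists h1 h2 m1 m2, [/\ arc h1 g, arc h2 g, h1 != h2
      & [/\ computes h1 m1, computes h2 m2 & m = (m1 `+` m2)%mset]]
  end.
Proof.
case=> {g m} [g x ->|g ->|g h m -> hg hm|g h1 h2 m1 m2 -> h1g h2g h12 hm1 hm2] //.
  by exists h.
by exists h1, h2, m1, m2.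
Qed.

Lemma children2 g : arity (lab g) = 2%N ->
  exists h1 h2, h1 != h2 /\ forall h, arc h g = (h == h1) || (h == h2).
Proof.
rewrite -in_degree => /eqP/cards2P[h1 [h2 [h12 E]]].
by exists h1, h2; split=> // h; move/setP/(_ h): E; rewrite !inE.
Qed.

Lemma formula_size_gt0 g : (0 < formula_size g)%N.
Proof. by apply/card_gt0P; exists g; rewrite inE connect0. Qed.

Lemma formula_size_arc g h : arc h g -> (formula_size h < formula_size g)%N.
Proof.
move=> hg; apply: proper_card; apply/properP; split.
  apply/subsetP => x; rewrite !inE => /connect_trans; apply; exact: connect1.
exists g; rewrite !inE ?connect0 //.
by have /forallP/(_ h)/forallP/(_ g) := arc_acyclic C; rewrite hg.
Qed.

Hypothesis formC : is_formula C.

Lemma arc_functional g h h' : arc g h -> arc g h' -> h = h'.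
Proof.
by move=> gh gh'; have /card_le1_eqP := formC g; apply; rewrite inE.
Qed.

(** Out-degree at most one forces the walk leaving [g], so one of the two paths is a prefix of the
    other. *)
Lemma connect_comparable g h h' : connect arc g h -> connect arc g h' ->
  connect arc h h' || connect arc h' h.
Proof.
case/connectP=> s ps ->{h}; elim: s g ps => [|x s IHs] g /=; first by move=> _ ->.
case/andP=> gx ps /connectP[[|y s'] /= ps' E].
  apply/orP; right; rewrite E; apply/connectP; exists (x :: s) => //=.
  by rewrite gx.
case/andP: ps' => gy ps'; apply: IHs => //; rewrite (arc_functional gx gy).
by apply/connectP; exists s'.
Qed.

(** A path from [h1] to [h2] would start with the only arc out of [h1], into [g], and the arc from
    [h2] to [g] would close a cycle. *)
Lemma connect_children g h1 h2 : arc h1 g -> arc h2 g -> h1 != h2 ->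
  ~~ connect arc h1 h2.
Proof.
move=> h1g h2g h12; apply/negP => /connectP[[|x s] /= ps E].
  by rewrite E eqxx in h12.
case/andP: ps => h1x ps; have /forallP/(_ h2)/forallP/(_ g) := arc_acyclic C.
rewrite h2g /= => /negP; apply; rewrite (arc_functional h1g h1x).
by apply/connectP; exists s.
Qed.

(** A gate below both children would make them comparable, so the two subformulas are disjoint. *)
Lemma formula_size_children g h1 h2 : arc h1 g -> arc h2 g -> h1 != h2 ->
  (formula_size h1 + formula_size h2 <= formula_size g)%N.
Proof.
move=> h1g h2g h12; rewrite /formula_size.
set A1 := [set h | connect arc h h1]%SET; set A2 := [set h | connect arc h h2]%SET.
have I0 : A1 :&: A2 = set0.
  apply/setP => x; rewrite !inE; apply/negP => /andP[/connect_comparable xh1 /xh1].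
  rewrite (negPf (connect_children h1g h2g h12)).
  by rewrite (negPf (connect_children h2g h1g _)) // eq_sym.
rewrite -cardsUI I0 cards0 addn0.
apply/subset_leq_card/subsetP => x; rewrite !inE.
by case/orP=> /connect_trans; apply; apply: connect1.
Qed.

End Formula.

(** * The weight bound, by induction on the gates *)

Section GateBound.
Local Open Scope mset_scope.
Local Open Scope ring_scope.
Variables (R : realFieldType) (G : sgraph) (lam : R) (C : circuit G).
Hypotheses (lam_gt0 : 0 < lam) (lam_le1 : lam <= 1).
Hypothesis deg_lam : forall v : G, 2 * (degree v)%:R * lam <= 1.
Hypothesis formC : is_formula C.
Local Notation arc := (@Defs.arc _ C).
Implicit Types (g h : gate C) (m : {mset G}) (S U : {set G}).

Local Notation Z U := (weight lam (indeps U)).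
Local Notation q := (1 + lam / 2).

Definition monomials g : {set {set G}} :=
  [set S | `[< computes g (set_monomial S) >]]%SET.

(** [m0] is a context: a monomial that the rest of the formula can multiply onto what [g] computes.
    It carries the independence condition from the output down to inner gates. *)
Definition extendable g m0 : Prop := forall m, computes g m ->
  exists2 S : {set G}, independent S & (m0 `+` m)%mset = set_monomial S.

Lemma extendable_set g m0 m : extendable g m0 -> computes g m ->
  exists2 S, m = set_monomial S & independent S.
Proof.
move=> ext /[dup] gm /ext[S iS /set_monomial_factor[S' -> S'S]].
by exists S' => //; apply: independentS iS.
Qed.

Lemma monomialsP g S : reflect (computes g (set_monomial S)) (S \in monomials g).
Proof. by rewrite inE; apply: asboolP. Qed.

Lemma q_ge1 : 1 <= q. Proof. by have := lam_gt0; lra. Qed.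

(** At most one monomial weighs at most 1 because [lam <= 1], while the weight of [U] is at least
    [q ^+ #|U|]; a chain on all of [U] serves as forest. This settles leaves and plus gates without
    monomials. *)
Lemma single_monomial_bound g U :
  (forall S S', S \in monomials g -> S' \in monomials g -> S = S') ->
  exists2 k, treedepth_le U k
    & weight lam (monomials g) * q ^+ k <= (formula_size g)%:R * Z U.
Proof.
move=> uniqS; exists #|U|.
  have := treedepth_le_superset (sub0set U) (@treedepth_le0 G).
  by rewrite setD0.
have le1 : weight lam (monomials g) <= 1.
  case: (set_0Vmem (monomials g)) => [->|[S Sg]].
    by rewrite /weight big_set0 ler01.
  rewrite /weight (big_pred1 S) => [|S' /=].
    by rewrite exprn_ile1 // ltW.
  by apply/idP/eqP => [/uniqS|->] //; apply.
have := weight_indeps_superset lam_gt0 (sub0set U) deg_lam.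
rewrite weight_indeps0 setD0 mul1r => leZ.
have q0 : 0 <= q ^+ #|U| by apply/exprn_ge0/(le_trans ler01 q_ge1).
apply: (@le_trans _ _ (1 * Z U)); first by apply: ler_pM => //; apply: weight_ge0.
by rewrite ler_wpM2r ?weight_ge0 // ler1n formula_size_gt0.
Qed.

(** Only the factor with the larger depth bound contributes its inductive estimate; the other is
    bounded by the full weight of [B]. Each vertex of [U] outside [A :|: B] raises the depth by one
    and pays for it with a factor [q]. *)
Lemma product_bound A B U (M M1 M2 : {set {set G}}) k1 k2 s :
  separated A B -> A :|: B \subset U ->
  M1 \subset indeps A -> M2 \subset indeps B ->
  weight lam M <= weight lam M1 * weight lam M2 ->
  treedepth_le A k1 -> treedepth_le B k2 -> (k2 <= k1)%N ->
  weight lam M1 * q ^+ k1 <= s%:R * Z A ->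
  exists2 k, treedepth_le U k & weight lam M * q ^+ k <= s%:R * Z U.
Proof.
move=> sAB ABU M1A M2B leM tdA tdB k21 b1; exists (k1 + #|U :\: (A :|: B)|)%N.
  apply: treedepth_le_superset => //; apply: treedepth_leU => //.
  exact: treedepth_leW tdB.
have q0 n : 0 <= q ^+ n by apply/exprn_ge0/(le_trans ler01 q_ge1).
rewrite exprD mulrA.
apply: (@le_trans _ _ (s%:R * Z (A :|: B) * q ^+ #|U :\: (A :|: B)|)); last first.
  rewrite -mulrA ler_wpM2l ?ler0n //; exact: weight_indeps_superset.
rewrite ler_wpM2r //; apply: (@le_trans _ _ (s%:R * (Z A * Z B))); last first.
  by rewrite ler_wpM2l ?ler0n // weight_indeps_separated.
apply: (@le_trans _ _ (weight lam M1 * q ^+ k1 * weight lam M2)).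
  by rewrite mulrAC ler_wpM2r.
rewrite mulrA; apply: ler_pM => //; rewrite ?mulr_ge0 ?weight_ge0 //.
exact: weightS.
Qed.

(** Both [m0] and [U] vary in the induction. A max gate passes them on unchanged; a plus gate gives
    each child the union of its own supports, and enlarges the context by a monomial of the
    sibling. *)
Lemma gate_bound g m0 U : extendable g m0 ->
  (forall S, S \in monomials g -> S \subset U) ->
  exists2 k, treedepth_le U k
    & weight lam (monomials g) * q ^+ k <= (formula_size g)%:R * Z U.
Proof.
move: {2}(formula_size g) (leqnn (formula_size g)) => n.
elim: n g m0 U => [|n IHn] g m0 U szg ext gU.
  by have := leq_trans (formula_size_gt0 g) szg.
case Lg: (lab g) => [x|||].
- apply: single_monomial_bound => S S' /monomialsP/computes_inv + /monomialsP/computes_inv.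
  by rewrite Lg => E E'; apply: set_monomial_inj; rewrite E E'.
- apply: single_monomial_bound => S S' /monomialsP/computes_inv + /monomialsP/computes_inv.
  by rewrite Lg => E E'; apply: set_monomial_inj; rewrite E E'.
- have [|h1 [h2 [h12 arcg]]] := @children2 _ C g; first by rewrite Lg.
  have h1g : arc h1 g by rewrite arcg eqxx.
  have h2g : arc h2 g by rewrite arcg eqxx orbT.
  have szh := formula_size_children formC h1g h2g h12.
  have child h : arc h g -> exists2 k, treedepth_le U k
      & weight lam (monomials h) * q ^+ k <= (formula_size h)%:R * Z U.
    move=> hg; apply: (IHn h m0) => [|m hm|S].
    - by rewrite -ltnS (leq_trans (formula_size_arc hg)).
    - by apply: ext; apply: computes_max hm.
    - by move=> /monomialsP hS; apply/gU/monomialsP; apply: computes_max hS.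
  have [k1 td1 b1] := child _ h1g.
  have [k2 td2 b2] := child _ h2g.
  (* Both children bound the same [U], so the smaller depth is a valid bound and its power of [q] is
     below both others. *)
  exists (minn k1 k2); first by case: leqP.
  apply: (@le_trans _ _ ((formula_size h1 + formula_size h2)%N%:R * Z U)); last first.
    by rewrite ler_wpM2r ?weight_ge0 // ler_nat.
  apply: (@le_trans _ _
    ((weight lam (monomials h1) + weight lam (monomials h2)) * q ^+ minn k1 k2)).
    rewrite ler_wpM2r ?exprn_ge0 ?(le_trans ler01 q_ge1) //.
    apply: le_trans (weightU lam_gt0 _ _); apply: weightS => //.
    apply/subsetP => S; rewrite in_setU => /monomialsP/computes_inv.
    by rewrite Lg => -[h]; rewrite arcg => /orP[]/eqP-> /monomialsP->; rewrite ?orbT.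
  rewrite natrD !mulrDl; apply: lerD.
    apply: le_trans b1; rewrite ler_wpM2l ?weight_ge0 //.
    by rewrite ler_weXn2l ?q_ge1 ?geq_minl.
  apply: le_trans b2; rewrite ler_wpM2l ?weight_ge0 //.
  by rewrite ler_weXn2l ?q_ge1 ?geq_minr.
- have [|h1 [h2 [h12 arcg]]] := @children2 _ C g; first by rewrite Lg.
  have h1g : arc h1 g by rewrite arcg eqxx.
  have h2g : arc h2 g by rewrite arcg eqxx orbT.
  have prodg S1 S2 : S1 \in monomials h1 -> S2 \in monomials h2 ->
      computes g (set_monomial S1 `+` set_monomial S2).
    by move=> /monomialsP hS1 /monomialsP hS2; apply: computes_plus hS1 hS2.
  have splitg S : S \in monomials g -> exists S1 S2,
      [/\ S1 \in monomials h1, S2 \in monomials h2 &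
          set_monomial S1 `+` set_monomial S2 = set_monomial S].
    move=> /monomialsP/computes_inv; rewrite Lg.
    case=> [x [y [m1 [m2 [xg yg xy [xm1 ym2 ES]]]]]].
    have [S2 E2 _] := set_monomial_factor (esym ES).
    have [S1 E1 _] : exists2 S1, m1 = set_monomial S1 & S1 \subset S.
      by apply: (@set_monomial_factor _ m2); rewrite msetDC.
    move: xg yg xy xm1 ym2 ES; rewrite !arcg E1 E2.
    (* The rule for plus gates may list the children in either order; the swapped case uses
       commutativity. *)
    case/orP=> /eqP->; case/orP=> /eqP->; rewrite ?eqxx // => _ c1 c2 ->.
      by exists S1, S2; split=> //; apply/monomialsP.
    by exists S2, S1; rewrite msetDC; split=> //; apply/monomialsP.
  (* A child without monomials leaves [g] without any; otherwise [T1] and [T2] extend the contexts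
     of the siblings. *)
  case: (set_0Vmem (monomials h1)) => [h1_0|[T1 T1h]].
    by apply: single_monomial_bound => S S' /splitg[S1 [S2 []]]; rewrite h1_0 inE.
  case: (set_0Vmem (monomials h2)) => [h2_0|[T2 T2h]].
    by apply: single_monomial_bound => S S' /splitg[S1 [S2 [_]]]; rewrite h2_0 inE.
  have ext1 : extendable h1 (m0 `+` set_monomial T2).
    move=> m hm; rewrite -msetDA [_ `+` m]msetDC; apply: ext.
    by move/monomialsP: T2h; apply: computes_plus hm.
  have ext2 : extendable h2 (m0 `+` set_monomial T1).
    move=> m hm; rewrite -msetDA; apply: ext.
    by move/monomialsP: T1h => hT; apply: computes_plus hT hm.
  pose A := \bigcup_(S in monomials h1) S; pose B := \bigcup_(S in monomials h2) S.
  have prodI S1 S2 : S1 \in monomials h1 -> S2 \in monomials h2 ->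
      [/\ [disjoint S1 & S2], independent (S1 :|: S2) & S1 :|: S2 \in monomials g].
    move=> S1h S2h; have c12 := prodg _ _ S1h S2h.
    have [S E iS] := extendable_set ext c12.
    have [ES dS] := set_monomialD E; rewrite -ES; split=> //.
    by apply/monomialsP; rewrite -E.
  (* Every monomial of one child meets every monomial of the other in some product, which must be
     independent and square-free; this excludes common vertices and edges between the supports. *)
  have sAB : separated A B.
    move=> a b /bigcupP[S1 S1h aS1] /bigcupP[S2 S2h bS2].
    have [dS iS _] := prodI _ _ S1h S2h.
    rewrite (contraTneq _ aS1) => [|->]; last by rewrite (disjointFl dS bS2).
    move/forall_inP: iS => /(_ a); rewrite inE aS1 => /(_ isT)/forall_inP.
    by apply; rewrite inE bS2 orbT.
  have ABU : A :|: B \subset U.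
    rewrite subUset; apply/andP; split; apply/bigcupsP => S Sh.
      have [_ _ /gU] := prodI _ _ Sh T2h; apply: subset_trans; exact: subsetUl.
    have [_ _ /gU] := prodI _ _ T1h Sh; apply: subset_trans; exact: subsetUr.
  have indep_h h m S : extendable h m -> S \in monomials h -> independent S.
    move=> exth /monomialsP/(extendable_set exth)[S'].
    by move/set_monomial_inj->.
  have M1A : monomials h1 \subset indeps A.
    apply/subsetP => S Sh; rewrite inE (indep_h _ _ _ ext1) //.
    exact: bigcup_sup.
  have M2B : monomials h2 \subset indeps B.
    apply/subsetP => S Sh; rewrite inE (indep_h _ _ _ ext2) //.
    exact: bigcup_sup.
  have leg : weight lam (monomials g) <=
      weight lam (monomials h1) * weight lam (monomials h2).
    apply: weight_le_mul => // S /splitg[S1 [S2 [S1h S2h /set_monomialD[ES dS]]]].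
    exists S1, S2; split=> //; rewrite ES cardsU.
    by move: dS; rewrite -setI_eq0 => /eqP->; rewrite cards0 subn0.
  have [|S|k1 td1 b1] := IHn h1 _ A _ ext1.
  + by rewrite -ltnS (leq_trans (formula_size_arc h1g)).
  + exact: bigcup_sup.
  have [|S|k2 td2 b2] := IHn h2 _ B _ ext2.
  + by rewrite -ltnS (leq_trans (formula_size_arc h2g)).
  + exact: bigcup_sup.
  have sizeW h : arc h g -> (formula_size h)%:R * Z U <= (formula_size g)%:R * Z U.
    move=> hg; rewrite ler_wpM2r ?weight_ge0 // ler_nat.
    exact/ltnW/formula_size_arc.
  (* The child with the larger depth bound plays the role of [A] in [product_bound]. *)
  case: (leqP k2 k1) => [k21|/ltnW k12].
    have [k tdU bU] := product_bound sAB ABU M1A M2B leg td1 td2 k21 b1.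
    by exists k => //; apply: le_trans bU (sizeW _ h1g).
  rewrite setUC in ABU; rewrite mulrC in leg.
  have [k tdU bU] := product_bound (separated_sym sAB) ABU M2B M1A leg td2 td1 k12 b2.
  by exists k => //; apply: le_trans bU (sizeW _ h2g).
Qed.

End GateBound.

(** * The bound at the output and the choice of constants *)

Theorem theorem5 (R : realType) :
  exists2 c : R, 0 < c &
    forall (G : sgraph) (t d : nat),
      treedepth G = t -> max_degree G = d -> (1 <= d)%N ->
      forall C : circuit G, mwis_formula C ->
        2 `^ (c * t%:R / d%:R) <= #|gate C|%:R.
Proof.
(* The constant comes from [2 <= q ^+ (4 * d)], proved below. *)
exists 4^-1; first by rewrite invr_gt0 ltr0n.
move=> G t d tdG degG d1 C [formC [monI indM]].
have d0 : 0 < d%:R :> R by rewrite ltr0n.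
have d1R : 1 <= d%:R :> R by rewrite ler1n.
pose lam : R := (2 * d%:R)^-1.
have lam0 : 0 < lam by rewrite invr_gt0 mulr_gt0 ?ltr0n.
have dlam : 2 * d%:R * lam = 1 by rewrite mulfV // mulf_neq0 ?pnatr_eq0 -?lt0n.
have lam1 : lam <= 1 by rewrite invf_le1 ?mulr_gt0 ?ltr0n //; lra.
have deg_lam (v : G) : 2 * (degree v)%:R * lam <= 1.
  rewrite -[leRHS]dlam ler_wpM2r ?(ltW lam0) // ler_wpM2l ?ler0n // ler_nat -degG.
  exact: leq_bigmax.
have [||k tdk] := gate_bound lam0 lam1 deg_lam formC
  (g := output C) (m0 := mset0) (U := [set: G]%SET).
- by move=> m /monI[S iS ->]; exists S; rewrite ?mset0D.
- by move=> S _; apply: subsetT.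
have -> : monomials (output C) = indeps [set: G]%SET.
  apply/setP => S; rewrite [RHS]inE subsetT andbT.
  apply/monomialsP/idP => [/monI[S' iS' /set_monomial_inj->]|/indM] //.
set q := 1 + lam / 2 => bound.
have Z0 : 0 < weight lam (indeps [set: G]%SET).
  rewrite (lt_le_trans ltr01) // -(weight_indeps0 G lam).
  exact/weightS/indepsS/sub0set.
have q1 : 1 <= q by rewrite /q; lra.
(* The output computes all independent sets, so the same positive weight stands on both sides and
   cancels. *)
have qk : q ^+ k <= #|gate C|%:R.
  rewrite mulrC ler_pM2r // in bound; apply: le_trans bound _.
  by rewrite ler_nat max_card.
have tk : (t <= k)%N by rewrite -tdG; apply: treedepth_le_treedepth.
apply: le_trans qk; apply: (@le_trans _ _ (q ^+ t)); last exact: ler_weXn2l.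
have q2 : 2 <= q ^+ (4 * d).
  have bern n : 1 + n%:R * (lam / 2) <= q ^+ n.
    elim: n => [|n IHn]; first by rewrite mul0r addr0 expr0.
    rewrite exprS -natr1; apply: le_trans (ler_wpM2l _ IHn); last by lra.
    have : 0 <= n%:R * (lam / 2) * (lam / 2) by rewrite !mulr_ge0 ?ler0n //; lra.
    by rewrite /q; lra.
  (* Here [4 * d * (lam / 2) = 1], so Bernoulli gives exactly [1 + 1]. *)
  apply: le_trans (bern _); rewrite natrM; have := dlam; lra.
have q0 : 0 <= q by lra.
apply: (@le_trans _ _ ((q ^+ (4 * d)) `^ (4^-1 * t%:R / d%:R))).
  apply: ge0_ler_powR; rewrite ?nnegrE ?exprn_ge0 //.
  by rewrite !mulr_ge0 ?invr_ge0 ?ler0n // ltW.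
rewrite -powR_mulrn // -powRrM natrM.
have -> : 4 * d%:R * (4^-1 * t%:R / d%:R) = t%:R :> R by field; rewrite gt_eqF.
by rewrite powR_mulrn.
Qed.
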